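(* There is a complete semigroup $(S,\prod)$ such that $S$ is a countable set and there are elements $a,b,e\in S$ such that $a\neq e$, $b\neq e$, $ab=e$, and $e$ is a complete identity of $(S,\prod)$.
   Context: A linearly-indexed sequence of elements of $S$ is a family $(a_i)_{i\in I}$ with each $a_i\in S$, where $I$ is an arbitrary linearly ordered set (possibly empty). An infinitary semigroup is a nonempty class $S$ together with a (partial) class function $\prod$ with values in $S$, whose domain consists of a class of linearly-indexed sequences of elements of $S$; the image of $(a_i)_{i\in I}$, when defined, is denoted $\prod_{i\in I}a_i$. The following two properties are required. (U) If $I=\{i\}$ has exactly one element, then $\prod_{i\in I}a_i$ is defined and equal to $a_i$. (N) Whenever $\prod_{i\in I}a_i$ is defined, $J$ is a linearly ordered set and $\pi:I\to J$ is a surjective order preserving map (i.e. $i\le i'$ implies $\pi(i)\le\pi(i')$), then all products in the equation $\prod_{i\in I}a_i=\prod_{j\in J}\ \prod_{i\in I_j}a_i$ are defined and the equality holds, where $I_j=\{i\in I\mid \pi(i)=j\}$ carries the order induced from $I$. It follows from (U) and (N) that products are invariant under order-isomorphic reindexing. The notation $ab$ means the product of the two-element sequence whose first term is $a$ and whose second term is $b$. A complete semigroup is an infinitary semigroup such that $\prod_{i\in I}a_i$ is defined for every nonempty linearly-indexed sequence of elements of $S$ (that is, for every nonempty linearly ordered set $I$ and every family $(a_i)_{i\in I}$ of elements of $S$). An element $e\in S$ is a complete identity if: whenever $\prod_{i\in I}a_i$ is defined and the (not necessarily convex) subset $H=\{i\in I\mid a_i\neq e\}$ of $I$ is given the induced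 order, then $\prod_{i\in H}a_i$ is defined, too, and $\prod_{i\in I}a_i=\prod_{i\in H}a_i$. (In particular, the product of the empty sequence is then defined and equal to $e$.) *)

(* Defs.v *)
From HB Require Import structures.
From mathcomp Require Import all_boot all_order.
From mathcomp Require Import boolp classical_sets cardinality.

Set Implicit Arguments.
Unset Strict Implicit.
Unset Printing Implicit Defensive.

Local Open Scope order_scope.

Definition suborder d (I : orderType d) (P : pred I) : Type := {i : I | P i}.

HB.instance Definition _ d (I : orderType d) (P : pred I) :=
  SubChoice.copy (suborder P) {i : I | P i}.
HB.instance Definition _ d (I : orderType d) (P : pred I) :=
  [SubChoice_isSubOrder of suborder P by <: with d].

Definition restrict_seq S d (I : orderType d) (a : I -> S) (P : pred I) :
  suborder P -> S := fun i => a (val i).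

(* None means undefined.  Linear orders are orderTypes; the choice structure and
   the display they carry have no mathematical content, since infsg_nest for the
   identity map and infsg_unit below make products independent of them. *)
Definition partial_product (S : Type) : Type :=
  forall (d : Order.disp_t) (I : orderType d), (I -> S) -> option S.

Definition is_defined T (x : option T) : Prop := exists y, x = Some y.

Record infinitary_semigroup (S : Type) (prod : partial_product S) : Prop := {
  infsg_nonempty : inhabited S;
  infsg_unit : forall d (I : orderType d) (a : I -> S) (i : I),
    (forall i', i' = i) -> prod d I a = Some (a i);
  (* b j is the inner product over the fibre of j; as prod is a function, b is
     unique once the inner products are all defined. *)
  infsg_nest : forall d (I : orderType d) d' (J : orderType d')
      (pi : I -> J) (a : I -> S),
    is_defined (prod d I a) ->
    (forall j, exists i, pi i = j) ->
    {homo pi : i i' / i <= i'} ->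
    exists b : J -> S,
      (forall j, prod d _ (restrict_seq a (P := fun i => pi i == j))
                 = Some (b j)) /\
      is_defined (prod d' J b) /\
      prod d I a = prod d' J b
}.

Record complete_semigroup (S : Type) (prod : partial_product S) : Prop := {
  complete_infsg : infinitary_semigroup prod;
  complete_defined : forall d (I : orderType d) (a : I -> S),
    inhabited I -> is_defined (prod d I a)
}.

Definition prod2 S (prod : partial_product S) (a b : S) : option S :=
  prod _ 'I_2 (tnth [tuple a; b]).

Definition complete_identity S (prod : partial_product S) (e : S) : Prop :=
  forall d (I : orderType d) (a : I -> S),
    is_defined (prod d I a) ->
    let aH := restrict_seq a (P := fun i => `[< a i <> e >]) in
    is_defined (prod d _ aH) /\ prod d I a = prod d _ aH.

(* Main.v *)
(* S is the bicyclic monoid <a, b | ab = 1> with a zero, and e = 1.  A word over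
   S is read as a walk on the integers in which the letter b^m a^n goes down m
   steps and then up n steps.  Since a (ba)(ba)... = (ab)(ab)... = e forces
   (ba)(ba)... = b, the height of the walk at a limit cut of the index order has
   to be the limit inferior of the heights next to it, on either side.  The
   product of a word is zero if no height function on the cuts has this
   property, and otherwise it is the element b^m a^n given by the start, the
   minimum and the end of the walk.  By a Baire-type argument the height function
   is unique up to a constant.  Height functions pass to quotients and lift
   along any monotone map whose fibres have height functions; for surjective maps
   this is (N), and for the inclusion of H into I, whose fibres are singletons or
   empty, it says that e is a complete identity. *)
Require Import Defs.
From mathcomp Require Import all_boot all_order.
From mathcomp Require Import boolp classical_sets cardinality.
From mathcomp Require Import zify.

Local Open Scope classical_set_scope.

Set Implicit Arguments.
Unset Strict Implicit.
Unset Printing Implicit Defensive.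

(** * Linear orders, cuts and height functions *)

Record linear_order (T : Type) (le : T -> T -> Prop) : Prop := {
  lin_refl : forall x, le x x;
  lin_trans : forall y x z, le x y -> le y z -> le x z;
  lin_anti : forall x y, le x y -> le y x -> x = y;
  lin_total : forall x y, le x y \/ le y x
}.

Definition dual T (le : T -> T -> Prop) : T -> T -> Prop := fun x y => le y x.

Lemma linear_dual T (le : T -> T -> Prop) :
  linear_order le -> linear_order (dual le).
Proof.
case=> r t a tot; split=> [x|y x z xy yz|x y xy yx|x y]; rewrite /dual.
- exact: r.
- exact: t yz xy.
- exact: a.
- by case: (tot x y); [right|left].
Qed.

Lemma nle_le T (le : T -> T -> Prop) x y :
  linear_order le -> ~ le x y -> le y x.
Proof. by move=> lin nxy; case: (lin_total lin x y). Qed.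

(** A cut is represented by its lower part, and complements turn cuts into cuts of the dual order.
    With strictness written as a negation, the complement of [upto le i] is [below (dual le) i] by
    definition. *)
Definition below T (le : T -> T -> Prop) (i : T) : set T := [set j | ~ le i j].
Definition upto T (le : T -> T -> Prop) (i : T) : set T := [set j | le j i].

Definition downset T (le : T -> T -> Prop) (A : set T) : Prop :=
  forall i j, A j -> le i j -> A i.

Lemma downsetC T (le : T -> T -> Prop) (A : set T) :
  downset le A -> downset (dual le) (~` A).
Proof. by move=> dA i j nAj ji Ai; apply/nAj/(dA _ _ Ai). Qed.

Lemma downset_below T (le : T -> T -> Prop) i :
  linear_order le -> downset le (below le i).
Proof. by move=> lin j k /= nik jk ij; apply/nik/(lin_trans lin ij jk). Qed.

Lemma downset_upto T (le : T -> T -> Prop) i :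
  linear_order le -> downset le (upto le i).
Proof. by move=> lin j k /= ki jk; apply: (lin_trans lin jk ki). Qed.

(* An element (m, n) stands for b^m a^n in the bicyclic monoid, where ab = 1;
   None is an adjoined zero. *)
Definition bicyclic0 : Type := option (nat * nat).

Definition unit0 : bicyclic0 := Some (0, 0).

(* Seen as a walk, b^m a^n goes from height p down to k and up to q. *)
Definition spans (s : bicyclic0) (k p q : nat) : Prop :=
  [/\ k <= p, k <= q & s = Some (p - k, q - k)].

(** The anti-automorphism exchanging the two generators, which reverses walks. *)
Definition swap0 (s : bicyclic0) : bicyclic0 := omap (fun v => (v.2, v.1)) s.

Lemma spans_swap s k p q : spans s k p q -> spans (swap0 s) k q p.
Proof. by case=> kp kq ->; split. Qed.

Definition limit_cut T (le : T -> T -> Prop) (A : set T) : Prop :=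
  [/\ downset le A, A !=set0 & forall i, A i -> exists2 j, A j & ~ le j i].

(* [h A] is the limit inferior of [mu] from the left at every limit cut [A] *)
Definition liminf_at_cuts T (le : T -> T -> Prop) (h : set T -> nat)
    (mu : T -> nat) : Prop :=
  forall A, limit_cut le A ->
    (exists2 j, A j & forall i, A i -> le j i -> h A <= mu i) /\
    (forall j, A j -> exists i, [/\ A i, le j i & mu i <= h A]).

(* [h] is the height of the walk at each cut, [mu i] its lowest height within
   the letter [i]. *)
Record height T (le : T -> T -> Prop) (a : T -> bicyclic0) (h : set T -> nat)
    (mu : T -> nat) : Prop := {
  ht_letter : forall i, spans (a i) (mu i) (h (below le i)) (h (upto le i));
  ht_left : liminf_at_cuts le h mu;
  ht_right : liminf_at_cuts (dual le) (fun A => h (~` A)) mu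
}.

(** Reading the walk backwards; this turns every left-sided argument into a right-sided one. *)
Lemma height_dual T (le : T -> T -> Prop) a h mu :
  height le a h mu -> height (dual le) (swap0 \o a) (fun A => h (~` A)) mu.
Proof.
case=> hl hL hR; split=> //.
- move=> i /=; have := spans_swap (hl i).
  by rewrite -[upto le i]setCK.
- by under [fun _ => _]funext do rewrite setCK.
Qed.

(** * First passage of a walk to a level *)

Lemma max_or_limit T (le : T -> T -> Prop) (A : set T) :
    linear_order le -> downset le A -> A !=set0 ->
  (exists i, A = upto le i) \/ limit_cut le A.
Proof.
move=> lin dA A0; case: (pselect (exists2 i, A i & forall j, A j -> le j i)).
  move=> [i Ai mi]; left; exists i; apply/seteqP; split=> // j ji.
  exact: dA Ai ji.
move=> nmax; right; split=> // i Ai; apply: contrapT => nj; apply: nmax.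
exists i => // j Aj; apply: contrapT => nji; apply: nj.
by exists j.
Qed.

Section FirstHit.
Context (T : Type) (le : T -> T -> Prop) (a : T -> bicyclic0)
  (h : set T -> nat) (mu : T -> nat).
Context (lin : linear_order le) (ht : height le a h mu).

(** A last letter of [y] ends at height [h y]; if there is none, the left limit inferior at [y]
    supplies a letter beyond the given one. *)
Lemma letter_cut (x y : set T) : downset le x -> downset le y ->
    (exists2 i, y i & ~ x i) ->
  exists i, [/\ y i, ~ x i & mu i <= h y].
Proof.
move=> dx dy [i yi nxi].
have [|[j yE]|lim] := max_or_limit lin dy; first by exists i.
  exists j; split; first by rewrite yE; exact: (lin_refl lin).
    by move=> xj; apply/nxi/(dx _ _ xj); rewrite yE in yi.
  by rewrite yE; case: (ht_letter ht j).
have [_ /(_ _ yi)[j [yj ij hj]]] := ht_left ht lim.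
by exists j; split=> // xj; apply/nxi/(dx _ _ xj).
Qed.

Lemma cut_ge (x y : set T) k : downset le x -> downset le y ->
    (exists2 i, y i & ~ x i) -> (forall i, y i -> ~ x i -> k <= mu i) ->
  k <= h y.
Proof.
move=> dx dy e kmu; have [i [yi nxi hi]] := letter_cut dx dy e.
exact: leq_trans (kmu _ yi nxi) hi.
Qed.

(** The cut [p] before all letters that hit level [k] still has height above [k]. If no letter came
    first after [p], the right limit inferior at [p] would keep the walk above [k] a little further,
    against the choice of [p]. So a letter follows [p] immediately, and it is the first hit. *)
Lemma first_hit (x : set T) k i0 : downset le x -> k < h x ->
    ~ x i0 -> mu i0 <= k ->
  exists i, [/\ ~ x i, le i i0, mu i <= k, k < h (below le i) &
    forall j, ~ x j -> ~ le i j -> k < mu j].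
Proof.
move=> dx kx nxi0 mui0.
pose p := [set j | x j \/ forall j', le j' j -> ~ x j' -> k < mu j'].
have dp : downset le p.
  move=> i j [xj|mj] ij; first by left; exact: dx xj ij.
  by right=> j' j'i; apply: mj; exact: lin_trans ij.
have kp : k < h p.
  case: (pselect (exists2 i, p i & ~ x i)) => [e|ne].
    apply: (cut_ge dx dp e) => i [//|pi] nxi.
    by apply: pi nxi; exact: (lin_refl lin).
  suff -> : p = x by [].
  apply/seteqP; split=> i; last by left.
  by move=> pi; apply: contrapT => nxi; apply: ne; exists i.
have npi0 : ~ p i0.
  case=> // /(_ i0 (lin_refl lin i0) nxi0).
  by rewrite ltnNge mui0.
have [|[i iE]|lim] := max_or_limit (linear_dual lin) (downsetC dp).
- by exists i0.
- have pE : p = below le i by rewrite -[p]setCK iE.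
  have npi : ~ p i by rewrite pE => /=; apply; exact: (lin_refl lin).
  have [nxi [j [ji nxj muj]]] :
      ~ x i /\ exists j, [/\ le j i, ~ x j & mu j <= k].
    split; first by move=> xi; apply: npi; left.
    apply: contrapT => nj; apply: npi; right=> j ji nxj.
    by rewrite ltnNge; apply/negP => muj; apply: nj; exists j.
  have ij : le i j.
    apply: contrapT => nij; have [//|pj] : p j by rewrite pE.
    by have := pj j (lin_refl lin j) nxj; rewrite ltnNge muj.
  have eij : i = j by apply: (lin_anti lin).
  exists i; split=> //; last 2 first.
  + by rewrite -pE.
  + move=> j' nxj' nij'; have [//|pj] : p j' by rewrite pE.
    by apply: pj nxj'; exact: (lin_refl lin).
  + by have : (~` p) i0 by []; rewrite iE.
  + by rewrite eij.
- have [[j npj mj] _] := ht_right ht lim; exfalso; apply: npj.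
  right=> j' j'j nxj'; case: (pselect (p j')) => [[//|pj]|npj'].
    by apply: pj nxj'; exact: (lin_refl lin).
  by apply: leq_trans (mj _ npj' j'j); rewrite setCK.
Qed.

End FirstHit.

(** If a letter lies between [x] and [z], the bound reaches [z] from the left; otherwise one lies
    between [z] and [y], and the dual argument applies. *)
Lemma cut_between T (le : T -> T -> Prop) a h mu (x z y : set T) k :
    linear_order le -> height le a h mu ->
    downset le x -> downset le z -> downset le y -> x `<=` z -> z `<=` y ->
    (exists2 i, y i & ~ x i) -> (forall i, y i -> ~ x i -> k <= mu i) ->
  k <= h z.
Proof.
move=> lin ht dx dz dy xz zy [i yi nxi] kmu.
case: (pselect (z i)) => [zi|nzi].
  apply: (cut_ge lin ht dx dz); first by exists i.
  by move=> j zj nxj; apply: kmu => //; apply: zy.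
rewrite -[z]setCK; apply: (cut_ge (linear_dual lin) (height_dual ht)
  (downsetC dy) (downsetC dz)); first by exists i => // /(_ yi).
by move=> j nzj /contrapT yj; apply: kmu => // xj; exact/nzj/xz.
Qed.

(** * Uniqueness of the height function up to a constant *)

Lemma ex_min_value T (P : set T) (f : T -> nat) : P !=set0 ->
  exists2 i, P i & forall j, P j -> f i <= f j.
Proof.
case=> i Pi; pose Q n := `[< exists2 j, P j & f j = n >].
have exQ : exists n, Q n by exists (f i); apply/asboolP; exists i.
case: (ex_minnP exQ) => n /asboolP[j Pj <-] minj.
by exists j => // j' Pj'; apply: minj; apply/asboolP; exists j'.
Qed.

(** The inequation says that [h1] and [h2] have different increments from [x] to [y], written
    without subtraction; [k1] and [k2] bound the two walks from below in this gap. *)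
Definition discrepancy T (le : T -> T -> Prop) (h1 h2 : set T -> nat)
    (mu1 mu2 : T -> nat) (k1 k2 : nat) (x y : set T) : Prop :=
  [/\ downset le x, downset le y, x `<=` y, h1 x + h2 y <> h2 x + h1 y &
    forall i, y i -> ~ x i -> k1 <= mu1 i /\ k2 <= mu2 i].

Lemma discrepancy_nonempty T (le : T -> T -> Prop) h1 h2 mu1 mu2 k1 k2 x y :
    discrepancy (T := T) le h1 h2 mu1 mu2 k1 k2 x y ->
  exists2 i, y i & ~ x i.
Proof.
case=> _ _ xy dxy _; apply: contrapT => ne; apply: dxy.
suff -> : x = y by rewrite addnC.
apply/seteqP; split=> // i yi; apply: contrapT => nxi.
by apply: ne; exists i.
Qed.

Lemma discrepancy_dual T (le : T -> T -> Prop) h1 h2 mu1 mu2 k1 k2 x y :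
    discrepancy (T := T) le h1 h2 mu1 mu2 k1 k2 x y ->
  discrepancy (dual le) (fun A => h1 (~` A)) (fun A => h2 (~` A)) mu1 mu2 k1 k2
    (~` y) (~` x).
Proof.
case=> dx dy xy dxy kmu; split=> /=; try exact: downsetC.
- exact: subsetC.
- by rewrite !setCK => e; apply: dxy; lia.
- by move=> i nxi /contrapT yi; exact: kmu.
Qed.

(** The gap is cut off just before the first letter [i] at which the second walk reaches [k2]. Both
    walks drop equally on entering [i], so there [h1 - h2] is at least [k1 - k2], which exceeds its
    value at [x]: the discrepancy persists while [k2] grows. *)
Lemma refine_from_left T (le : T -> T -> Prop) a h1 h2 mu1 mu2 k1 k2 x y i0 :
    linear_order le -> height (T := T) le a h1 mu1 -> height le a h2 mu2 ->
    discrepancy le h1 h2 mu1 mu2 k1 k2 x y ->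
    y i0 -> ~ x i0 -> mu2 i0 <= k2 -> h1 x + k2 < h2 x + k1 ->
  exists y', y' `<=` y /\ discrepancy le h1 h2 mu1 mu2 k1 k2.+1 x y'.
Proof.
move=> lin ht1 ht2 D yi0 nxi0 mui0 dlt.
have ne := discrepancy_nonempty D.
have [dx dy xy _ kmu] := D.
have k1x : k1 <= h1 x.
  apply: (cut_between lin ht1 dx dx dy _ xy ne) => // i yi nxi.
  by case: (kmu i).
have k2x : k2 < h2 x by lia.
have [i [nxi ii0 mui hi muj]] := first_hit lin ht2 dx k2x nxi0 mui0.
have yi : y i by exact: dy yi0 ii0.
have sub : below le i `<=` y.
  by move=> j /(nle_le lin) ji; exact: dy yi ji.
exists (below le i); split => //; split=> //.
- exact: downset_below.
- by move=> j xj /= ij; apply/nxi/(dx _ _ xj).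
- have [k1i k2i] := kmu i yi nxi.
  have [m1 _ e1] := ht_letter ht1 i; have [m2 _] := ht_letter ht2 i.
  by rewrite e1 => -[e _]; lia.
- move=> j ji nxj; split; last exact: muj.
  by case: (kmu j (sub _ ji) nxj).
Qed.

Lemma discrepancy_sym T (le : T -> T -> Prop) h1 h2 mu1 mu2 k1 k2 x y :
    discrepancy (T := T) le h1 h2 mu1 mu2 k1 k2 x y ->
  discrepancy le h2 h1 mu2 mu1 k2 k1 x y.
Proof.
case=> dx dy xy dxy kmu; split=> // [e|i yi nxi]; first by apply: dxy.
by case: (kmu i yi nxi).
Qed.

Lemma refine_left T (le : T -> T -> Prop) a h1 h2 mu1 mu2 k1 k2 x y i1 i2 :
    linear_order le -> height (T := T) le a h1 mu1 -> height le a h2 mu2 ->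
    discrepancy le h1 h2 mu1 mu2 k1 k2 x y ->
    y i1 -> ~ x i1 -> mu1 i1 <= k1 -> y i2 -> ~ x i2 -> mu2 i2 <= k2 ->
    h1 x + k2 <> h2 x + k1 ->
  exists x' y' k1' k2', [/\ x `<=` x', y' `<=` y, k1 + k2 < k1' + k2' &
    discrepancy le h1 h2 mu1 mu2 k1' k2' x' y'].
Proof.
move=> lin ht1 ht2 D y1 x1 mu1i y2 x2 mu2i ne.
have [lt|gt|//] := ltngtP (h1 x + k2) (h2 x + k1).
  have [y' [sy D']] := refine_from_left lin ht1 ht2 D y2 x2 mu2i lt.
  by exists x, y', k1, k2.+1; split=> //; lia.
have [y' [sy D']] :=
  refine_from_left lin ht2 ht1 (discrepancy_sym D) y1 x1 mu1i gt.
exists x, y', k1.+1, k2; split=> //.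
exact: discrepancy_sym.
Qed.

(** The bounds are first raised to the attained minima, so that first hits exist; then the gap is
    shortened from one of its ends. *)
Lemma refine_discrepancy T (le : T -> T -> Prop) a h1 h2 mu1 mu2 k1 k2 x y :
    linear_order le -> height (T := T) le a h1 mu1 -> height le a h2 mu2 ->
    discrepancy le h1 h2 mu1 mu2 k1 k2 x y ->
  exists x' y' k1' k2', [/\ x `<=` x', y' `<=` y, k1 + k2 < k1' + k2' &
    discrepancy le h1 h2 mu1 mu2 k1' k2' x' y'].
Proof.
move=> lin ht1 ht2 D.
have ne0 : [set i | y i /\ ~ x i] !=set0.
  by have [i yi nxi] := discrepancy_nonempty D; exists i.
have [i1 [y1 x1] min1] := ex_min_value mu1 ne0.
have [i2 [y2 x2] min2] := ex_min_value mu2 ne0.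
have [dx dy xy dxy kmu] := D.
have D' : discrepancy le h1 h2 mu1 mu2 (mu1 i1) (mu2 i2) x y.
  by split=> // i yi nxi; split; [exact: min1|exact: min2].
have le1 : k1 <= mu1 i1 by case: (kmu i1).
have le2 : k2 <= mu2 i2 by case: (kmu i2).
(* If [h1 - h2] agreed with the difference of the minima at both ends, there would be no
   discrepancy. *)
have [nex|ney] : h1 x + mu2 i2 <> h2 x + mu1 i1 \/
    h1 y + mu2 i2 <> h2 y + mu1 i1 by lia.
  have [x' [y' [k1' [k2' [xx' yy' kk D'']]]]] :=
    refine_left lin ht1 ht2 D' y1 x1 (leqnn _) y2 x2 (leqnn _) nex.
  by exists x', y', k1', k2'; split=> //; lia.
have nn (i : T) : y i -> ~ (~` y) i by move=> yi; apply.
rewrite -[y]setCK in ney.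
have [x' [y' [k1' [k2' [xx' yy' kk D'']]]]] :=
  refine_left (linear_dual lin) (height_dual ht1) (height_dual ht2)
    (discrepancy_dual D') x1 (nn _ y1) (leqnn _) x2 (nn _ y2) (leqnn _) ney.
exists (~` y'), (~` x'), k1', k2'; split.
- by rewrite -[x]setCK; exact: subsetC.
- by rewrite -[y]setCK; exact: subsetC.
- lia.
- have := discrepancy_dual D''.
  by rewrite /discrepancy !setCK.
Qed.

(* A discrepancy shrinks to gaps along which the heights tend to infinity;
   these gaps have a common cut, whose height would be infinite. *)
Lemma height_unique T (le : T -> T -> Prop) a h1 h2 mu1 mu2 x y :
    linear_order le -> height (T := T) le a h1 mu1 -> height le a h2 mu2 ->
    downset le x -> downset le y -> x `<=` y ->
  h1 x + h2 y = h2 x + h1 y.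
Proof.
move=> lin ht1 ht2 dx dy xy; apply: contrapT => ne.
(* A state is a gap with its two bounds; iterating a choice of refinements gives nested gaps. *)
pose state := (set T * set T * nat * nat)%type.
pose D (s : state) := discrepancy le h1 h2 mu1 mu2 s.1.2 s.2 s.1.1.1 s.1.1.2.
pose R (s s' : state) := [/\ s.1.1.1 `<=` s'.1.1.1, s'.1.1.2 `<=` s.1.1.2,
  s.1.2 + s.2 < s'.1.2 + s'.2 & D s'].
have /choice[f fP] (s : state) : exists s', D s -> R s s'.
  case: (pselect (D s)) => [Ds|nDs]; last by exists s.
  have [x' [y' [k1 [k2 H]]]] := refine_discrepancy lin ht1 ht2 Ds.
  by exists (x', y', k1, k2).
pose s n := iter n f (x, y, 0, 0).
have Ds n : D (s n).
  by elim: n => [|n /fP[]//]; split.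
have Rs n : R (s n) (s n.+1) by exact: fP.
have mono m n : m <= n -> (s m).1.1.1 `<=` (s n).1.1.1 /\
    (s n).1.1.2 `<=` (s m).1.1.2.
  elim: n => [|n IH]; first by rewrite leqn0 => /eqP ->; split.
  rewrite leq_eqVlt => /orP[/eqP->|]; [by split|rewrite ltnS => /IH[H1 H2]].
  by have [H3 H4 _ _] := Rs n; split; [move=> i /H1/H3|move=> i /H4/H2].
have grow n : n <= (s n).1.2 + (s n).2.
  by elim: n => // n IH; have [_ _ lt _] := Rs n; exact: leq_ltn_trans lt.
pose z := \bigcup_n (s n).1.1.1.
have dz : downset le z.
  by move=> i j [n _ xj] ij; exists n => //; case: (Ds n) => dxn _ _ _ _;
     exact: dxn ij.
(* The bounds of gap [n] add up to at least [n], yet [z] lies in this gap, so they are at most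
   [h1 z] and [h2 z]. *)
pose n := (h1 z + h2 z).+1.
have xz : (s n).1.1.1 `<=` z by move=> i xi; exists n.
have zy : z `<=` (s n).1.1.2.
  move=> i [m _ xi]; case: (Ds (maxn m n)) => _ _ sub _ _.
  have [sm _] := mono _ _ (leq_maxl m n); have [_ sn] := mono _ _ (leq_maxr m n).
  exact/sn/sub/sm.
have Dn := Ds n; have ne' := discrepancy_nonempty Dn.
have [dxn dyn _ _ kmu] := Dn.
have : (s n).1.2 <= h1 z.
  by apply: (cut_between lin ht1 dxn dz dyn xz zy ne') => i yi /(kmu i yi)[].
have : (s n).2 <= h2 z.
  by apply: (cut_between lin ht2 dxn dz dyn xz zy ne') => i yi /(kmu i yi)[].
have := grow n; rewrite {1}/n; lia.
Qed.

(** * Stretches of unit letters *)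

Lemma letter_under_cut T (le : T -> T -> Prop) a h mu x (i0 : T) :
    linear_order le -> height le a h mu -> downset le x ->
  exists i, mu i <= h x.
Proof.
move=> lin ht dx; case: (pselect (x i0)) => [xi|nxi].
  have [||i [_ _]] := letter_cut lin ht (x := set0) _ dx; [by []| |by exists i].
  by exists i0.
have [||i [_ _ /=]] := letter_cut (linear_dual lin) (height_dual ht) (x := set0)
  _ (downsetC dx); [by []| |by rewrite setCK; exists i].
by exists i0.
Qed.

(** A unit letter is entered at its lowest height, so it is never the first hit of a level below the
    starting height. Hence the height cannot fall along the stretch, and by duality it cannot
    rise. *)
Lemma unit_stretch T (le : T -> T -> Prop) a h mu x y :
    linear_order le -> height (T := T) le a h mu ->
    downset le x -> downset le y -> x `<=` y ->
    (forall i, y i -> ~ x i -> a i = unit0) ->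
  h x = h y.
Proof.
have half (le' : T -> T -> Prop) a' h' x' y' : linear_order le' ->
    height le' a' h' mu -> downset le' x' -> downset le' y' -> x' `<=` y' ->
    (forall i, y' i -> ~ x' i -> a' i = unit0) -> h' x' <= h' y'.
  move=> lin ht dx dy xy un; rewrite leqNgt; apply/negP => lt.
  case: (pselect (exists2 i, y' i & ~ x' i)) => [e|ne]; last first.
    suff E : x' = y' by rewrite E ltnn in lt.
    apply/seteqP; split=> // i yi; apply: contrapT => nxi.
    by apply: ne; exists i.
  have [i0 [yi0 nxi0 mui0]] := letter_cut lin ht dx dy e.
  have [i [nxi ii0 mui hi _]] := first_hit lin ht dx lt nxi0 mui0.
  have := ht_letter ht i; rewrite (un i (dy _ _ yi0 ii0) nxi).
  by case=> _ _ [E _]; lia.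
move=> lin ht dx dy xy un; apply/eqP; rewrite eqn_leq; apply/andP; split.
  exact: half lin ht dx dy xy un.
have := half _ _ _ (~` y) (~` x) (linear_dual lin) (height_dual ht)
  (downsetC dy) (downsetC dx).
rewrite !setCK; apply; first exact: subsetC.
by move=> i nxi /contrapT yi /=; rewrite un.
Qed.

(* If only letters outside [N] came back to the level [h C], the first of them
   after a letter of [N] would be a unit reached from a strictly higher cut. *)
Lemma liminf_essential T (le : T -> T -> Prop) a h mu (N C : set T) :
    linear_order le -> height (T := T) le a h mu ->
    (forall i, ~ N i -> a i = unit0) -> limit_cut le C ->
    (forall j, C j -> exists j', [/\ C j', N j' & le j j']) ->
  forall j, C j -> exists j', [/\ C j', N j', le j j' & mu j' <= h C].
Proof.
move=> lin ht un lim cofN j Cj; apply: contrapT => none.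
have nohit j' : C j' -> N j' -> le j j' -> h C < mu j'.
  move=> Cj' Nj' jj'; rewrite ltnNge; apply/negP => mu_le.
  by apply: none; exists j'.
have [j1 [Cj1 Nj1 jj1]] := cofN j Cj.
have lt1 : h C < h (upto le j1).
  by apply: leq_trans (nohit _ Cj1 Nj1 jj1) _; case: (ht_letter ht j1).
have [dC _ nmax] := lim.
have [j2 Cj2 nj21] := nmax j1 Cj1.
have [_ /(_ j2 Cj2)[i0 [Ci0 j2i0 mui0]]] := ht_left ht lim.
have ni0 : ~ upto le j1 i0 by move=> H; apply/nj21/(lin_trans lin j2i0 H).
have [i [ni ii0 mui hi _]] :=
  first_hit lin ht (downset_upto (i := j1) lin) lt1 ni0 mui0.
have Ci : C i by exact: dC Ci0 ii0.
have ji : le j i by apply: (lin_trans lin jj1); exact: (nle_le lin ni).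
case: (pselect (N i)) => [Ni|nNi]; first by have := nohit i Ci Ni ji; lia.
have := ht_letter ht i; rewrite un// => -[_ _ [E _]]; lia.
Qed.

(** * The value of a word *)

(** In a nonempty word the minimum is attained within a letter, since cuts are never lower than all
    letters; the empty word has only the cut [set0]. *)
Definition lowest T (h : set T -> nat) (mu : T -> nat) (k : nat) : Prop :=
  (forall i, k <= mu i) /\
  ((exists i, mu i <= k) \/ (T -> False) /\ k = h set0).

Lemma ex_lowest T (h : set T -> nat) (mu : T -> nat) : exists k, lowest h mu k.
Proof.
case: (pselect (exists i : T, True)) => [[i _]|ne].
  have [|j _ minj] := ex_min_value (P := [set: T]) mu; first by exists i.
  by exists (mu j); split=> [i'|]; [exact: minj|left; exists j].
have emp : T -> False by move=> i; apply: ne; exists i.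
by exists (h set0); split=> [i|]; [case: (emp i)|right].
Qed.

Lemma lowest_le_cut T (le : T -> T -> Prop) a h mu k x :
    linear_order le -> height (T := T) le a h mu -> lowest h mu k ->
    downset le x -> k <= h x.
Proof.
move=> lin ht [kmu low] dx; case: low => [[i _]|[emp ->]].
  by apply: (cut_between (x := set0) (y := setT) lin ht) => //; exists i.
suff -> : x = set0 by [].
by apply/seteqP; split=> // i; case: (emp i).
Qed.

(** Only nonzero [s] can occur, because [spans] excludes [None]. *)
Definition evaluates T (le : T -> T -> Prop) (a : T -> bicyclic0)
    (s : bicyclic0) : Prop :=
  exists h mu k, [/\ height le a h mu, lowest h mu k &
    spans s k (h set0) (h setT)].

Lemma evaluates_height T (le : T -> T -> Prop) a h mu k :
    linear_order le -> height (T := T) le a h mu -> lowest h mu k ->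
  evaluates le a (Some (h set0 - k, h setT - k)).
Proof.
move=> lin ht low; exists h, mu, k; split=> //.
by split=> //; exact: (lowest_le_cut lin ht low).
Qed.

(** Two height functions differ by a constant on cuts. Each letter fixes the drop from its entry to
    its minimum, so the same constant separates the minima. *)
Lemma evaluates_unique T (le : T -> T -> Prop) a s s' :
    linear_order le -> evaluates (T := T) le a s -> evaluates le a s' -> s = s'.
Proof.
move=> lin [h1 [mu1 [k1 [ht1 [km1 low1] [l1 l1' ->]]]]].
move=> [h2 [mu2 [k2 [ht2 [km2 low2] [l2 l2' ->]]]]].
have d0 : downset le set0 by [].
have dT : downset le setT by [].
have E := height_unique lin ht1 ht2 d0 dT (@sub0set _ _).
have Emu i : mu1 i + h2 set0 = mu2 i + h1 set0.
  have := height_unique lin ht1 ht2 d0 (downset_below (i := i) lin)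
    (@sub0set _ _).
  have [m1 _ e1] := ht_letter ht1 i; have [m2 _] := ht_letter ht2 i.
  by rewrite e1 => -[e _]; lia.
have Ek : k1 + h2 set0 = k2 + h1 set0.
  case: low1 low2 => [[i1 i1k]|[emp e1]] [[i2 i2k]|[emp2 e2]];
    try by [case: emp|case: emp2]; last by lia.
  have := Emu i1; have := Emu i2; have := km1 i1; have := km2 i2.
  have := km1 i2; have := km2 i1; lia.
by congr (Some (_, _)); lia.
Qed.

(** A height function may be shifted, so the walk can be placed at any prescribed level that fits
    [s]. *)
Lemma evaluates_at T (le : T -> T -> Prop) a s k p q :
    linear_order le -> evaluates (T := T) le a s -> spans s k p q ->
  exists h mu, [/\ height le a h mu, lowest h mu k, h set0 = p & h setT = q].
Proof.
move=> lin [h [mu [k0 [ht low [l l' ->]]]]] [kp kq [e1 e2]].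
have hk := lowest_le_cut lin ht low.
(* The truncated subtraction is exact on letters and cuts, whose heights are at least [k0]. *)
pose sh n := n - k0 + k.
exists (sh \o h), (sh \o mu); split; rewrite /sh /=; try lia.
- split.
  + move=> i; have [m1 m2 ->] := ht_letter ht i; have := low.1 i => ki.
    by split=> /=; [| |congr (Some (_, _))]; lia.
  + move=> A lim; have [[j Aj Hj] H] := ht_left ht lim; split.
      by exists j => // i Ai ji; have := Hj i Ai ji => /=; lia.
    by move=> i /H[i' [Ai' ii' /= mui']]; exists i'; split=> //=; lia.
  + move=> A lim; have [[j Aj Hj] H] := ht_right ht lim; split.
      by exists j => // i Ai ji; have := Hj i Ai ji => /=; lia.
    by move=> i /H[i' [Ai' ii' /= mui']]; exists i'; split=> //=; lia.
- case: low => km low; split=> [i|]; rewrite /=; first lia.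
  case: low => [[i ik]|[emp ek]]; first by left; exists i => /=; lia.
  by right; split=> //=; lia.
Qed.

(** The default [None] makes the product zero when there is no height function. *)
Definition value T (le : T -> T -> Prop) (a : T -> bicyclic0) : bicyclic0 :=
  xget None [set s | evaluates le a s].

Lemma valueE T (le : T -> T -> Prop) a s :
  linear_order le -> evaluates (T := T) le a s -> value le a = s.
Proof.
move=> lin ev; apply: xget_unique => // s' ev'.
exact: evaluates_unique ev' ev.
Qed.

Lemma value_evaluates T (le : T -> T -> Prop) a v :
  value (T := T) le a = Some v -> evaluates le a (Some v).
Proof. by rewrite /value; case: xgetP => // s -> ev <-. Qed.

Lemma limit_cut_max T (le : T -> T -> Prop) (A : set T) t :
  linear_order le -> limit_cut le A -> A t -> ~ (forall j, A j -> le j t).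
Proof. by move=> lin [_ _ nmax] /nmax[j Aj nj] /(_ j Aj). Qed.

Lemma value_empty T (le : T -> T -> Prop) a :
  linear_order le -> (T -> False) -> value (T := T) le a = unit0.
Proof.
move=> lin emp; apply: valueE => //.
exists (fun=> 0), (fun=> 0), 0; split=> //.
  by split=> [i|A [_ [i _] _]|A [_ [i _] _]]; case: (emp i).
by split=> //; right.
Qed.

Lemma value_single T (le : T -> T -> Prop) a t :
  linear_order le -> (forall t', t' = t) -> value (T := T) le a = a t.
Proof.
move=> lin all.
have nolim (le' : T -> T -> Prop) : linear_order le' -> forall A,
    ~ limit_cut le' A.
  move=> lin' A lim; have [_ [j Aj] _] := lim.
  apply: (limit_cut_max lin' lim Aj) => i _.
  by rewrite (all i) (all j); exact: (lin_refl lin').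
have bE i : below le i = set0.
  apply/seteqP; split=> // j /=; rewrite (all i) (all j); apply.
  exact: (lin_refl lin).
have uE i : upto le i = setT.
  apply/seteqP; split=> // j _; rewrite (all i) (all j).
  exact: (lin_refl lin).
case E : (a t) => [[m n]|]; last first.
  rewrite /value; case: xgetP => // s -> [h [mu [k [ht _ _]]]].
  by case: (ht_letter ht t); rewrite E.
apply: valueE => //.
(* The letter goes from height [m] down to 0 and up to [n]. *)
exists (fun A => if `[< A t >] then n else m), (fun=> 0), 0.
have T0 : (if `[< [set: T] t >] then n else m) = n by rewrite asboolT.
have F0 : (if `[< (@set0 T) t >] then n else m) = m by rewrite asboolF.
split.
- split.
  + move=> i; rewrite bE uE T0 F0 (all i) E.
    by split=> //; rewrite !subn0.
  + by move=> A /nolim-/(_ lin).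
  + by move=> A /nolim-/(_ (linear_dual lin)).
- by split=> //; left; exists t.
- by rewrite T0 F0; split=> //; rewrite !subn0.
Qed.

(** * Monotone maps and the cuts of their fibres *)

(* [T j] is an isomorphic copy of the fibre of [pi] over [j]; it may be empty. *)
Record fibration I J (leI : I -> I -> Prop) (leJ : J -> J -> Prop) (pi : I -> J)
    (T : J -> Type) (leT : forall j, T j -> T j -> Prop)
    (iota : forall j, T j -> I) : Prop := {
  fib_linI : linear_order leI;
  fib_linJ : linear_order leJ;
  fib_mono : forall i i', leI i i' -> leJ (pi i) (pi i');
  fib_pi : forall j t, pi (iota j t) = j;
  fib_surj : forall j i, pi i = j -> exists t, iota j t = i;
  fib_inj : forall j, injective (iota j);
  fib_le : forall j t t', leT j t t' <-> leI (iota j t) (iota j t')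
}.

Section Fibration.
Context I J (leI : I -> I -> Prop) (leJ : J -> J -> Prop) (pi : I -> J)
  (T : J -> Type) (leT : forall j, T j -> T j -> Prop)
  (iota : forall j, T j -> I).
Context (fib : fibration leI leJ pi leT iota).

Lemma fibration_dual :
  fibration (dual leI) (dual leJ) pi (fun j => dual (leT (j := j))) iota.
Proof.
case: fib => lI lJ m p s inj le; split=> //; try exact: linear_dual.
- by move=> i i'; exact: m.
- by move=> j t t'; exact: le.
Qed.

Lemma fib_linT j : linear_order (leT (j := j)).
Proof.
have linI := fib_linI fib; have e := fib_le fib (j := j); split.
- by move=> t; apply/e; exact: (lin_refl linI).
- by move=> t x z /e H1 /e H2; apply/e; exact: (lin_trans linI H1 H2).
- move=> t t' /e H1 /e H2; apply: (fib_inj fib).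
  exact: (lin_anti linI H1 H2).
- by move=> t t'; case: (lin_total linI (iota t) (iota t')) => /e; [left|right].
Qed.

Lemma fib_lt i i' : ~ leJ (pi i') (pi i) -> leI i i'.
Proof.
move=> n; apply: (nle_le (fib_linI fib)) => H; apply: n.
exact: (fib_mono fib).
Qed.

Lemma downset_preim C : downset leJ C -> downset leI (pi @^-1` C).
Proof. by move=> dC i i' Ci ii'; apply: dC Ci _; exact: (fib_mono fib). Qed.

(** Carries a cut of the fibre over [j] to a cut of [I]; the extreme cuts of the fibre give the
    preimages of the two cuts of [J] around [j]. *)
Definition splice j (B : set (T j)) : set I :=
  [set i | ~ leJ j (pi i)] `|` [set iota t | t in B].

Lemma splice_iota j (B : set (T j)) t : splice B (iota t) <-> B t.
Proof.
split=> [[/=|[t' Bt' /(fib_inj fib) <-//]]|Bt]; last by right; exists t.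
by rewrite (fib_pi fib) => -[]; exact: (lin_refl (fib_linJ fib)).
Qed.

Lemma splice_lt j (B : set (T j)) i : ~ leJ j (pi i) -> splice B i.
Proof. by left. Qed.

Lemma splice_le j (B : set (T j)) i : splice B i -> leJ (pi i) j.
Proof.
have linJ := fib_linJ fib.
case=> [|[t _ <-]]; first exact: (nle_le linJ).
by rewrite (fib_pi fib); exact: (lin_refl linJ).
Qed.

Lemma downset_splice j (B : set (T j)) :
  downset (leT (j := j)) B -> downset leI (splice B).
Proof.
have linJ := fib_linJ fib.
move=> dB i i' Bi' ii'; have mii' := fib_mono fib ii'.
case: (pselect (leJ j (pi i))) => [ji|]; last exact: splice_lt.
have pi_i : pi i = j.
  by apply: (lin_anti linJ _ ji); exact: (lin_trans linJ mii' (splice_le Bi')).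
have pi_i' : pi i' = j.
  apply: (lin_anti linJ (splice_le Bi')).
  exact: (lin_trans linJ ji mii').
have [t ti] := fib_surj fib pi_i; have [t' ti'] := fib_surj fib pi_i'.
rewrite -ti; apply/splice_iota; move: Bi'; rewrite -ti' => /splice_iota Bt'.
by apply: dB Bt' _; apply/(fib_le fib); rewrite ti ti'.
Qed.

Lemma splice_set0 j : splice (@set0 (T j)) = pi @^-1` below leJ j.
Proof. by rewrite /splice image_set0 setU0. Qed.

Lemma splice_setT j : splice [set: T j] = pi @^-1` upto leJ j.
Proof.
have linJ := fib_linJ fib.
apply/seteqP; split=> i; first exact: splice_le.
move=> /= ij; case: (pselect (leJ j (pi i))) => [ji|]; last exact: splice_lt.
have [t <-] := fib_surj fib (lin_anti linJ ij ji).
exact/splice_iota.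
Qed.

Lemma splice_below j (t : T j) :
  splice (below (leT (j := j)) t) = below leI (iota t).
Proof.
have linJ := fib_linJ fib.
apply/seteqP; split=> i.
  case=> [n /(fib_mono fib)|[t' nt <-]]; first by rewrite (fib_pi fib).
  by move=> /(fib_le fib).
move=> n; case: (pselect (leJ j (pi i))) => [ji|]; last exact: splice_lt.
have ij : leJ (pi i) j.
  rewrite -(fib_pi fib t); apply: (fib_mono fib).
  exact: (nle_le (fib_linI fib) n).
have [t' E] := fib_surj fib (lin_anti linJ ij ji).
rewrite -E in n *; apply/splice_iota => /(fib_le fib); exact: n.
Qed.

Lemma splice_upto j (t : T j) :
  splice (upto (leT (j := j)) t) = upto leI (iota t).
Proof.
have linJ := fib_linJ fib.
apply/seteqP; split=> i.
  case=> [n|[t' nt <-]]; last by apply/(fib_le fib).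
  by apply: fib_lt; rewrite (fib_pi fib).
move=> it; case: (pselect (leJ j (pi i))) => [ji|]; last exact: splice_lt.
have ij : leJ (pi i) j by rewrite -(fib_pi fib t); apply: (fib_mono fib).
have [t' E] := fib_surj fib (lin_anti linJ ij ji).
by rewrite -E in it *; apply/splice_iota/(fib_le fib).
Qed.

(** The spliced cut is a limit cut of [I], and since [B] is nonempty, the letters of [B] are cofinal
    in it. *)
Lemma liminf_fibre h mu j : liminf_at_cuts leI h mu ->
  liminf_at_cuts (leT (j := j)) (fun B => h (splice B)) (mu \o iota (j := j)).
Proof.
have [[linI linJ] linT] := (fib_linI fib, fib_linJ fib, fib_linT j).
move=> lim B [dB [t Bt] nmax].
have limS : limit_cut leI (splice B).
  split; [exact: downset_splice| by exists (iota t); apply/splice_iota |].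
  move=> i Bi; case: (pselect (leJ j (pi i))) => [ji|nji].
    have [t' E] := fib_surj fib (lin_anti linJ (splice_le Bi) ji).
    move: Bi; rewrite -E => /splice_iota/nmax[u Bu nu].
    by exists (iota u); [apply/splice_iota|move=> /(fib_le fib)].
  exists (iota t); first exact/splice_iota.
  by move=> /(fib_mono fib); rewrite (fib_pi fib).
have up i : splice B i -> exists2 u, B u & leI i (iota u).
  move=> Bi; case: (pselect (leJ j (pi i))) => [ji|nji].
    have [t' E] := fib_surj fib (lin_anti linJ (splice_le Bi) ji).
    move: Bi; rewrite -E => /splice_iota Bt'.
    by exists t' => //; exact: (lin_refl linI).
  by exists t => //; apply: fib_lt; rewrite (fib_pi fib).
have [[i Bi Hi] H] := lim _ limS; split.
  have [u Bu iu] := up i Bi; exists u => // u' Bu' /(fib_le fib) uu'.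
  by apply: Hi; [exact/splice_iota|exact: (lin_trans linI iu uu')].
move=> u Bu; have [|i' [Bi' ui' mui']] := H (iota u); first exact/splice_iota.
have ji' : leJ j (pi i') by rewrite -(fib_pi fib u); exact: (fib_mono fib).
have [t' E] := fib_surj fib (lin_anti linJ (splice_le Bi') ji').
by subst i'; exists t'; split=> //; [exact/splice_iota|exact/(fib_le fib)].
Qed.

End Fibration.

Lemma spliceC I J (leI : I -> I -> Prop) leJ (pi : I -> J) T leT iota j
    (B : set (T j)) :
  fibration leI leJ pi leT iota ->
  ~` splice (dual leJ) pi iota B = splice leJ pi iota (~` B).
Proof.
move=> fib; have [linI linJ] := (fib_linI fib, fib_linJ fib).
have fib' := fibration_dual fib.
apply/seteqP; split=> i.
  move=> nB; case: (pselect (leJ j (pi i))) => [ji|]; last exact: splice_lt.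
  have ij : leJ (pi i) j by apply: contrapT => n; apply: nB; left.
  have [t E] := fib_surj fib (lin_anti linJ ij ji).
  rewrite -E in nB *; apply/(splice_iota fib) => Bt.
  by apply: nB; apply/(splice_iota fib').
move=> Bi; case: (pselect (leJ j (pi i))) => [ji|nji].
  have [t E] := fib_surj fib (lin_anti linJ (splice_le fib Bi) ji).
  rewrite -E in Bi *; move=> /(splice_iota fib') Bt.
  by move: Bi => /(splice_iota fib).
by move=> /(splice_le fib').
Qed.

(** * Passing from a word to its nested word *)

Section Push.
Context I J (leI : I -> I -> Prop) (leJ : J -> J -> Prop) (pi : I -> J)
  (T : J -> Type) (leT : forall j, T j -> T j -> Prop)
  (iota : forall j, T j -> I) (a : I -> bicyclic0).
Context (fib : fibration leI leJ pi leT iota).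

Lemma height_fibre h mu j : height leI a h mu ->
  height (leT (j := j)) (a \o iota (j := j))
    (fun B => h (splice leJ pi iota B)) (mu \o iota (j := j)).
Proof.
move=> ht; split.
- move=> t /=; rewrite (splice_below fib) (splice_upto fib).
  exact: (ht_letter ht).
- exact: (liminf_fibre fib (ht_left ht)).
- have := liminf_fibre (fibration_dual fib) (j := j) (ht_right ht).
  by under [fun B : set (T j) => _]funext do rewrite (spliceC _ fib).
Qed.

Lemma lowest_dual X (h : set X -> nat) mu k :
  lowest h mu k -> lowest (fun A => h (~` A)) mu k.
Proof.
case=> km low; split=> //; case: low => [|[emp ->]]; [by left|right; split=> //].
by congr h; apply/seteqP; split=> i; case: (emp i).
Qed.

(** If the letters over [C] stay under some element of [C], all later fibres in [C] are empty and
    [k] is constantly the height of the cut there. Otherwise the preimage of [C] is a limit cut of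
    [I], and its limit inferior can be taken over the minima of the fibres. *)
Lemma liminf_push h mu k : height leI a h mu ->
  (forall j, lowest (fun B => h (splice leJ pi iota B)) (mu \o iota (j := j))
    (k j)) ->
  liminf_at_cuts leJ (fun C => h (pi @^-1` C)) k.
Proof.
have [linI linJ] := (fib_linI fib, fib_linJ fib).
move=> ht low C limC; have [dC [j0 Cj0] nmax] := limC.
have dA := downset_preim fib dC.
have below_sub j : C j -> pi @^-1` below leJ j `<=` pi @^-1` C.
  by move=> Cj i /(nle_le linJ) ij; exact: dC Cj ij.
have d_below j := downset_preim fib (downset_below (i := j) linJ).
case: (pselect (exists2 j, C j & forall i, C (pi i) -> leJ (pi i) j)).
  move=> [j1 Cj1 up]; have [j2 Cj2 n21] := nmax j1 Cj1.
  have kE j : C j -> leJ j2 j -> k j = h (pi @^-1` C).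
    move=> Cj j2j; have [_ [[t _]|[_ ->]]] := low j.
      have jj1 : leJ j j1.
        by have := up (iota t); rewrite (fib_pi fib); apply.
      by case: n21; exact: (lin_trans linJ j2j jj1).
    rewrite splice_set0; congr h; apply/seteqP; split; first exact: below_sub.
    move=> i Ci /= ji; apply: n21; apply: (lin_trans linJ j2j).
    exact: (lin_trans linJ ji (up _ Ci)).
  split; first by exists j2 => // j Cj j2j; rewrite kE.
  move=> j Cj; have [jj2|j2j] := lin_total linJ j j2.
    by exists j2; split=> //; rewrite kE//; exact: (lin_refl linJ).
  by exists j; split=> //; [exact: (lin_refl linJ)|rewrite kE].
move=> unb; have cof j : C j -> exists2 i, C (pi i) & ~ leJ (pi i) j.
  move=> Cj; apply: contrapT => n; apply: unb; exists j => // i Ci.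
  by apply: contrapT => nij; apply: n; exists i.
have limA : limit_cut leI (pi @^-1` C).
  split=> //; first by have [i Ci _] := cof _ Cj0; exists i.
  move=> i Ci; have [i' Ci' n] := cof _ Ci; exists i' => //.
  by move=> /(fib_mono fib).
have [[i0 Ci0 H0] H] := ht_left ht limA; split.
  (* Fibres from [pi i2] on lie after [i0], and [i1] separates [i0] from the cut before them, which
     settles the empty fibres. *)
  have [i1 Ci1 n10] := cof _ Ci0; have [i2 Ci2 n21] := cof _ Ci1.
  exists (pi i2) => // j Cj j2; have [_ [[t kt]|[_ ->]]] := low j.
    apply: leq_trans kt; apply: H0 => /=; first by rewrite (fib_pi fib).
    apply: (fib_lt fib); rewrite (fib_pi fib) => ji0.
    apply: n10; apply: (lin_trans linJ _ ji0); apply: (lin_trans linJ _ j2).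
    exact: (nle_le linJ n21).
  rewrite splice_set0.
  apply: (cut_ge linI ht (downset_upto (i := i0) linI) (d_below j)).
    exists i1 => /=; last by move=> /(fib_mono fib).
    by move=> ji1; apply: n21; exact: (lin_trans linJ j2 ji1).
  move=> i ij nii0; apply: H0; first exact: below_sub ij.
  exact: (nle_le linI nii0).
move=> j Cj; have [i Ci n] := cof j Cj; have [i' [Ci' ii' mui']] := H i Ci.
exists (pi i'); split=> //.
  apply: (lin_trans linJ _ (fib_mono fib ii')); exact: (nle_le linJ n).
have [t E] := fib_surj fib (erefl (pi i')).
by apply: leq_trans mui'; have [/(_ t) /=] := low (pi i'); rewrite E.
Qed.

End Push.

(** * Pushing values forward and lifting limit conditions *)

Section Liminf.
Context I J (leI : I -> I -> Prop) (leJ : J -> J -> Prop) (pi : I -> J)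
  (T : J -> Type) (leT : forall j, T j -> T j -> Prop)
  (iota : forall j, T j -> I) (a : I -> bicyclic0).
Context (fib : fibration leI leJ pi leT iota).

(** The height function restricts to every fibre, so all inner values are nonzero; the minima of the
    fibres and the heights at preimages of cuts then form a height function on [J] with the same
    start, minimum and end. *)
Lemma evaluates_push s : evaluates leI a s ->
  evaluates leJ (fun j => value (leT (j := j)) (a \o iota (j := j))) s.
Proof.
have [linI linJ] := (fib_linI fib, fib_linJ fib).
move=> [h [mu [k [ht low sp]]]].
pose hf j (B : set (T j)) := h (splice leJ pi iota B).
have htf j := height_fibre fib j ht.
have /choice[kJ lowJ] j := ex_lowest (@hf j) (mu \o iota (j := j)).
have kJ_cut j := lowest_le_cut (fib_linT fib j) (htf j) (lowJ j).
exists (fun C => h (pi @^-1` C)), kJ, k; split=> //; last first.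
- split.
  + move=> j; have [_ [[t kt]|[_ ->]]] := lowJ j.
      by apply: leq_trans kt; exact: low.1.
    rewrite /hf splice_set0; apply: (lowest_le_cut linI ht low).
    by apply: (downset_preim fib); exact: downset_below.
  + have [_ [[i ik]|[emp ->]]] := low.
      left; exists (pi i); have [t E] := fib_surj fib (erefl (pi i)).
      apply: leq_trans ik.
      by have := (lowJ (pi i)).1 t; rewrite /= E.
    (* An empty [I] may lie over a nonempty [J]; then any empty fibre attains the minimum. *)
    case: (pselect (exists j : J, True)) => [[j _]|ne]; last first.
      by right; split=> // j; apply: ne; exists j.
    left; exists j; have [_ [[t _]|[_ ->]]] := lowJ j.
      by case: (emp (iota t)).
    rewrite /hf splice_set0 (_ : _ @^-1` _ = set0)//.
    by apply/seteqP; split=> // i; case: (emp i).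
- split.
  + move=> j; rewrite -(splice_set0 leJ pi iota) -(splice_setT fib).
    split; [exact: kJ_cut|exact: kJ_cut|].
    apply: valueE; first exact: fib_linT fib j.
    exact: (evaluates_height (fib_linT fib j) (htf j) (lowJ j)).
  + exact: (liminf_push fib ht lowJ).
  + apply: (liminf_push (fibration_dual fib) (height_dual ht)) => j.
    under [fun B : set (T j) => _]funext do rewrite (spliceC _ fib).
    exact: lowest_dual (lowJ j).
Qed.

Lemma splice_preim j (A : set I) :
    (forall i, ~ leJ j (pi i) -> A i) -> (forall i, A i -> leJ (pi i) j) ->
  A = splice leJ pi iota (iota (j := j) @^-1` A).
Proof.
move=> lo up; apply/seteqP; split=> i.
  move=> Ai; case: (pselect (leJ j (pi i))) => [ji|]; last exact: splice_lt.
  have [t E] := fib_surj fib (lin_anti (fib_linJ fib) (up _ Ai) ji).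
  by rewrite -E in Ai *; exact/(splice_iota fib).
by case=> [/lo//|[t At <-]].
Qed.

(** A limit cut that ends inside a fibre inherits the condition from that fibre. Any other is the
    preimage of a limit cut [C] of [J]: the lower bound holds because [mu] bounds the letters of
    each fibre, and the upper bound needs low letters of [J] with nonempty fibre. *)
Lemma liminf_lift b h mu hT muT h' mu' : height leJ b h mu ->
    (forall j, (T j -> False) -> b j = unit0) ->
    (forall j, lowest (hT j) (muT j) (mu j)) ->
    (forall j, liminf_at_cuts (leT (j := j)) (hT j) (muT j)) ->
    (forall C, downset leJ C -> h' (pi @^-1` C) = h C) ->
    (forall j B, downset (leT (j := j)) B ->
      h' (splice leJ pi iota B) = hT j B) ->
    (forall j t, mu' (iota t) = muT j t) ->
  liminf_at_cuts leI h' mu'.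
Proof.
have [linI linJ] := (fib_linI fib, fib_linJ fib).
move=> ht b1 low limT h'C h'B mu'E A [dA [ia Aia] nmax].
case: (pselect (exists j, exists t : T j, [/\ A (iota t),
    (forall i, ~ leJ j (pi i) -> A i) & forall i, A i -> leJ (pi i) j])).
  move=> [j [t [At lo up]]]; pose B := iota (j := j) @^-1` A.
  have AE : A = splice leJ pi iota B by exact: splice_preim.
  have fibre (u : T j) i : leI (iota u) i -> A i -> exists t' : T j, iota t' = i.
    move=> ui Ai; apply: (fib_surj fib); apply: (lin_anti linJ (up _ Ai)).
    by rewrite -(fib_pi fib u); exact: (fib_mono fib).
  have limB : limit_cut (leT (j := j)) B.
    split; [|by exists t|].
      by move=> u u' Bu' /(fib_le fib) uu'; exact: dA Bu' uu'.
    move=> u Bu; have [i Ai n] := nmax _ Bu.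
    have [t' E] := fibre u i (nle_le linI n) Ai.
    exists t'; first by rewrite /B /= E.
    by move=> /(fib_le fib); rewrite E.
  have hA : h' A = hT j B by rewrite AE h'B//; case: limB.
  have [[u Bu Hu] H] := limT j B limB; rewrite hA; split.
    exists (iota u) => // i Ai ui; have [t' E] := fibre u i ui Ai.
    rewrite -E mu'E; apply: Hu; first by rewrite /B /= E.
    by apply/(fib_le fib); rewrite E.
  move=> i Ai; have [u' [Bu' iu']] : exists u', B u' /\ leI i (iota u').
    have [it|ti] := lin_total linI i (iota t); first by exists t.
    have [t' E] := fibre t i ti Ai; exists t'; rewrite /B /= E.
    by split=> //; exact: (lin_refl linI).
  have [v [Bv uv muv]] := H u' Bu'; exists (iota v); rewrite mu'E; split=> //.
  by apply: (lin_trans linI iu'); exact/(fib_le fib).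
move=> nosplit; pose C := [set j | exists2 i, A i & leJ j (pi i)].
have CA i : A i -> C (pi i) by exists i => //; exact: (lin_refl linJ).
have strict i : A i -> ~ (forall i', A i' -> leJ (pi i') (pi i)).
  move=> Ai up; apply: nosplit; exists (pi i).
  have [t E] := fib_surj fib (erefl (pi i)); exists t; rewrite E.
  split=> // i' /(fib_lt fib); exact: dA Ai.
have AE : A = pi @^-1` C.
  apply/seteqP; split=> [i /CA//|i' [i Ai i'i]].
  apply: contrapT => nAi'; apply: (strict i Ai) => i2 Ai2.
  apply: (lin_trans linJ _ i'i); apply: (fib_mono fib); apply: (nle_le linI).
  by move=> H; apply/nAi'/(dA _ _ Ai2).
have dC : downset leJ C.
  by move=> j j' [i Ai j'i] jj'; exists i => //; exact: (lin_trans linJ jj' j'i).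
have above i : A i -> exists2 i', A i' & ~ leJ (pi i') (pi i).
  move=> Ai; apply: contrapT => n; apply: (strict i Ai) => i' Ai'.
  by apply: contrapT => n'; apply: n; exists i'.
have limC : limit_cut leJ C.
  split=> //; first by exists (pi ia); exact: CA.
  move=> j [i Ai ji]; have [i' Ai' n] := above i Ai.
  exists (pi i'); first exact: CA.
  by move=> i'j; apply: n; exact: (lin_trans linJ i'j ji).
have -> : h' A = h C by rewrite AE h'C.
have muge i : mu (pi i) <= mu' i.
  have [t <-] := fib_surj fib (erefl (pi i)).
  by rewrite mu'E (fib_pi fib); exact: (low _).1.
split.
  have [[j [i Ai ji] Hj] _] := ht_left ht limC.
  exists i => // i' Ai' ii'; apply: leq_trans (muge i').
  by apply: Hj; [exact: CA|apply: (lin_trans linJ ji (fib_mono fib ii'))].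
(* Letters with empty fibre are units, so [liminf_essential] finds low letters among those in
   [N]. *)
pose N := [set j | exists t : T j, True].
move=> i Ai; have [i1 Ai1 n1] := above i Ai.
have [||j' [Cj' [t _] ij' muj']] := liminf_essential (N := N) linJ ht _ limC _
  (CA i1 Ai1).
- by move=> j nN; apply: b1 => t; apply: nN; exists t.
- move=> j [i2 Ai2 ji2]; exists (pi i2); split=> //; first exact: CA.
  by have [t _] := fib_surj fib (erefl (pi i2)); exists t.
have [_ [[u ku]|[emp _]]] := low j'; last by case: (emp t).
exists (iota u); rewrite mu'E; split; [|..|exact: leq_trans muj'].
  by rewrite AE /= (fib_pi fib).
apply: (fib_lt fib); rewrite (fib_pi fib) => j'i; apply: n1.
exact: (lin_trans linJ ij' j'i).
Qed.

End Liminf.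

(** * Lifting height functions and the nesting law *)

Section Nest.
Context I J (leI : I -> I -> Prop) (leJ : J -> J -> Prop) (pi : I -> J)
  (T : J -> Type) (leT : forall j, T j -> T j -> Prop)
  (iota : forall j, T j -> I) (a : I -> bicyclic0).
Context (fib : fibration leI leJ pi leT iota).

Lemma splice_inj j (B B' : set (T j)) :
  splice leJ pi iota B = splice leJ pi iota B' -> B = B'.
Proof.
move=> E; apply/seteqP; split=> t /(splice_iota fib) Bt; apply/(splice_iota fib).
  by rewrite -E.
by rewrite E.
Qed.

(* A cut of [I] lies strictly inside one fibre or is the preimage of a cut of
   [J], which is unique up to adding empty fibres, whose value is the unit. *)
Lemma ex_lift_cut b h mu hT A : height leJ b h mu ->
    (forall j, (T j -> False) -> b j = unit0) ->
    (forall j, hT j set0 = h (below leJ j)) ->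
    (forall j, hT j setT = h (upto leJ j)) ->
    downset leI A ->
  exists v, (forall C, downset leJ C -> A = pi @^-1` C -> v = h C) /\
    (forall j (B : set (T j)), A = splice leJ pi iota B -> v = hT j B).
Proof.
have [linI linJ] := (fib_linI fib, fib_linJ fib).
move=> ht b1 hT0 hT1 dA.
(* Cuts with equal preimages differ by empty fibres, hence by a stretch of units. *)
have uniq C C' : downset leJ C -> downset leJ C' ->
    pi @^-1` C = pi @^-1` C' -> h C = h C'.
  have sub D D' : downset leJ D -> downset leJ D' -> D `<=` D' ->
      pi @^-1` D = pi @^-1` D' -> h D = h D'.
    move=> dD dD' DD' E; apply: (unit_stretch linJ ht) => // j D'j nDj.
    apply: b1 => t; apply: nDj; rewrite -(fib_pi fib t).
    by rewrite -[D _]/((pi @^-1` D) (iota t)) E /= (fib_pi fib).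
  move=> dC dC' E; case: (pselect (C `<=` C')) => [|n]; first by move/sub; exact.
  have C'C : C' `<=` C.
    move=> j' C'j'; apply: contrapT => nCj'; apply: n => j Cj.
    apply: (dC' _ _ C'j'); apply: (nle_le linJ) => j'j.
    by apply: nCj'; exact: dC Cj j'j.
  by apply/esym/sub.
case: (pselect (exists2 C, downset leJ C & A = pi @^-1` C)) => [[C dC AE]|nC].
  exists (h C); split=> [C' dC' E|j B E].
    by apply: uniq => //; rewrite -AE.
  case: (pselect (C j)) => [Cj|nCj].
    have BE : B = setT.
      apply/seteqP; split=> // t _; apply/(splice_iota fib).
      by rewrite -E AE /= (fib_pi fib).
    rewrite BE hT1; apply: uniq => //; first exact: downset_upto.
    by rewrite -AE E BE (splice_setT fib).
  have BE : B = set0.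
    apply/seteqP; split=> // t /(splice_iota fib).
    by rewrite -E AE /= (fib_pi fib).
  rewrite BE hT0; apply: uniq => //; first exact: downset_below.
  by rewrite -AE E BE splice_set0.
(* If no fibre met both [A] and its complement, [A] would be the preimage of the down-closure of its
   image. *)
have [i [i' [Ai nAi' E]]] : exists i i', [/\ A i, ~ A i' & pi i = pi i'].
  apply: contrapT => ns; apply: nC.
  exists [set j | exists2 i, A i & leJ j (pi i)].
    move=> j j' [i Ai j'i] jj'; exists i => //; exact: (lin_trans linJ jj' j'i).
  apply/seteqP; split=> [i Ai|i' [i Ai i'i]].
    by exists i => //; exact: (lin_refl linJ).
  apply: contrapT => nAi'; apply: ns; exists i, i'; split=> //.
  apply: (lin_anti linJ _ i'i); apply: (fib_mono fib); apply: (nle_le linI).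
  by move=> H; apply/nAi'/(dA _ _ Ai).
have AE : A = splice leJ pi iota (iota (j := pi i) @^-1` A).
  apply: (splice_preim fib) => [u /(fib_lt fib)|u Au]; first exact: dA Ai.
  rewrite E; apply: (fib_mono fib); apply: (nle_le linI).
  by move=> H; apply/nAi'/(dA _ _ Au).
exists (hT (pi i) (iota (j := pi i) @^-1` A)); split.
  by move=> C dC AC; case: nC; exists C.
move=> j B AB.
have ej : pi i = j.
  apply: (lin_anti linJ); first by apply: (splice_le fib (B := B)); rewrite -AB.
  rewrite E; apply: contrapT => n; apply: nAi'; rewrite AB.
  exact: splice_lt.
subst j; congr hT; apply: splice_inj.
by rewrite -AE.
Qed.

(** The height function of each fibre is shifted to match the walk over [J] at its letter; the
    shifted functions agree with [h] at the ends of the fibres and are glued. *)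
Lemma evaluates_lift s :
  evaluates leJ (fun j => value (leT (j := j)) (a \o iota (j := j))) s ->
  evaluates leI a s.
Proof.
have [linI linJ] := (fib_linI fib, fib_linJ fib).
set b := fun j => _; move=> [h [mu [k [ht low sp]]]].
have b1 j : (T j -> False) -> b j = unit0.
  exact: value_empty (fib_linT fib j).
have evT j : exists hm : (set (T j) -> nat) * (T j -> nat),
    [/\ height (leT (j := j)) (a \o iota (j := j)) hm.1 hm.2,
      lowest hm.1 hm.2 (mu j), hm.1 set0 = h (below leJ j) &
      hm.1 setT = h (upto leJ j)].
  have sj := ht_letter ht j; have [_ _ bj] := sj; rewrite bj in sj.
  have [h' [mu' H]] := evaluates_at (fib_linT fib j) (value_evaluates bj) sj.
  by exists (h', mu').
pose hT j := (projT1 (cid (evT j))).1.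
pose muT j := (projT1 (cid (evT j))).2.
have htT j : height (leT (j := j)) (a \o iota (j := j)) (hT j) (muT j).
  by rewrite /hT /muT; case: cid => hm [].
have lowT j : lowest (hT j) (muT j) (mu j).
  by rewrite /hT /muT; case: cid => hm [].
have hT0 j : hT j set0 = h (below leJ j) by rewrite /hT; case: cid => hm [].
have hT1 j : hT j setT = h (upto leJ j) by rewrite /hT; case: cid => hm [].
have /choice[h' h'P] A : exists v, downset leI A ->
    (forall C, downset leJ C -> A = pi @^-1` C -> v = h C) /\
    (forall j (B : set (T j)), A = splice leJ pi iota B -> v = hT j B).
  case: (pselect (downset leI A)) => [dA|]; last by exists 0.
  by have [v vP] := ex_lift_cut ht b1 hT0 hT1 dA; exists v.
have /choice[mu' mu'P] i : exists m, forall j (t : T j), iota t = i ->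
    m = muT j t.
  have [t E] := fib_surj fib (erefl (pi i)).
  exists (muT (pi i) t) => j t' E'.
  have ej : pi i = j by rewrite -E' (fib_pi fib).
  by subst j; congr muT; apply: (fib_inj fib); rewrite E.
have h'C C : downset leJ C -> h' (pi @^-1` C) = h C.
  by move=> dC; have [H _] := h'P _ (downset_preim fib dC); exact: H.
have h'B j B : downset (leT (j := j)) B ->
    h' (splice leJ pi iota B) = hT j B.
  by move=> dB; have [_ H] := h'P _ (downset_splice fib dB); exact: H.
have mu'E j t : mu' (iota t) = muT j t by exact: mu'P.
have ht' : height leI a h' mu'.
  split.
  + move=> i; have [t E] := fib_surj fib (erefl (pi i)); rewrite -E.
    rewrite -(splice_below fib) -(splice_upto fib) !h'B; last 2 first.
      by apply: downset_upto; exact: (fib_linT fib).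
      by apply: downset_below; exact: (fib_linT fib).
    by rewrite mu'E; exact: (ht_letter (htT _)).
  + exact: (liminf_lift fib ht b1 lowT (fun j => ht_left (htT j)) h'C h'B mu'E).
  + apply: (liminf_lift (fibration_dual fib) (height_dual ht) _
      (fun j => lowest_dual (lowT j)) (fun j => ht_right (htT j)) _ _ mu'E).
    * by move=> j /b1 /= ->.
    * by move=> C dC; rewrite preimage_setC h'C//; exact: downsetC dC.
    * by move=> j B dB; rewrite (spliceC _ fib) h'B//; exact: downsetC dB.
exists h', mu', k; split=> //; last first.
  by rewrite -(preimage_set0 pi) -(preimage_setT pi) !h'C.
split.
  move=> i; have [t <-] := fib_surj fib (erefl (pi i)); rewrite mu'E.
  by apply: leq_trans (low.1 (pi (iota t))) _; rewrite (fib_pi fib) (lowT _).1.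
case: (pselect (exists i : I, True)) => [[i _]|emp].
  left; have [_ [[j jk]|[empJ _]]] := low; last by case: (empJ (pi i)).
  have [_ [[t tj]|[_ ej]]] := lowT j.
    by exists (iota t); rewrite mu'E; exact: leq_trans jk.
  (* The lowest letter [j] has an empty fibre, so a letter of [I] as low as the cut before [j] takes
     its place. *)
  have dj := downset_below (i := j) linJ.
  have [i1 i1j] := letter_under_cut i linI ht' (downset_preim fib dj).
  exists i1; apply: leq_trans i1j _; rewrite h'C//.
  by rewrite -hT0 -ej.
have empI (i : I) : False by apply: emp; exists i.
right; split=> //; rewrite -(preimage_set0 pi) h'C//.
have [_ [[j jk]|[_ -> //]]] := low.
have empT j' (t : T j') : False by exact: empI (iota t).
(* Without letters in [I] all letters of [J] are units, and [h] is constant. *)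
have E : h set0 = h (below leJ j).
  apply: (unit_stretch linJ ht) => //; first exact: downset_below.
  by move=> j' _ _; apply: b1; exact: empT.
have [_ [[t _]|[_ ej]]] := lowT j; first by case: (empT _ t).
have := low.1 j; rewrite E -hT0 -ej; lia.
Qed.

(** Both words evaluate to the same elements by pushing and lifting; if there are none, both values
    are zero by default. *)
Lemma value_nest :
  value leI a = value leJ (fun j => value (leT (j := j)) (a \o iota (j := j))).
Proof.
set b := fun j => _.
case: (pselect (exists s, evaluates leI a s)) => [[s ev]|n].
  rewrite (valueE (fib_linI fib) ev).
  by rewrite (valueE (fib_linJ fib) (evaluates_push fib ev)).
rewrite /value !xgetPN// => s ev; apply: n; exists s => //.
exact: evaluates_lift.
Qed.

End Nest.

(** * The complete semigroup and its identity *)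

Definition ole d (I : orderType d) : I -> I -> Prop := fun x y => (x <= y)%O.

Lemma linear_ole d (I : orderType d) : linear_order (@ole d I).
Proof.
split=> [x|y x z|x y xy yx|x y]; rewrite /ole.
- exact: Order.POrderTheory.lexx.
- exact: Order.POrderTheory.le_trans.
- by apply: Order.POrderTheory.le_anti; rewrite [(x <= y)%O]xy.
- exact/orP/Order.TotalTheory.le_total.
Qed.

Definition order_product : partial_product bicyclic0 :=
  fun d I a => Some (value (@ole d I) a).

Lemma order_product_infsg : infinitary_semigroup order_product.
Proof.
split; first exact: (inhabits unit0).
  by move=> d I a i all; congr Some; apply: value_single => //; exact: linear_ole.
move=> d I d' J pi a _ sur mono.
pose T j := suborder (fun i => pi i == j).
pose iota j (t : T j) := val t.
have fib : fibration (@ole d I) (@ole d' J) pi (fun j => @ole d (T j)) iota.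
  split=> //; try exact: linear_ole.
  - by move=> j t; apply/eqP; exact: (valP t).
  - move=> j i /eqP ij; by exists (Sub i ij); rewrite /iota SubK.
  - by move=> j; exact: val_inj.
exists (fun j => value (@ole d (T j)) (restrict_seq a (P := fun i => pi i == j))).
split=> //; split; first by eexists.
by rewrite /order_product (value_nest a fib).
Qed.

(** The nesting law is applied to the inclusion of the non-unit indices: its fibre over [i] is a
    singleton with value [a i], or empty with value the unit, which is then [a i] too. *)
Lemma order_product_identity : complete_identity order_product unit0.
Proof.
move=> d I a _; set P : pred I := (fun i => _) => aH; split; first by eexists.
pose H := suborder P.
pose T i := {t : H | val t = i}.
pose iota i (t : T i) := projT1 t.
have fib : fibration (@ole d H) (@ole d I) val
    (fun i (t t' : T i) => ole (iota i t) (iota i t')) iota.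
  split=> //; try exact: linear_ole.
  - by move=> i t; exact: projT2 t.
  - by move=> i t E; exists (exist _ t E).
  - by move=> i [t E] [t' E'] /= e; apply: eq_exist.
rewrite /order_product (value_nest aH fib); congr (Some (value _ _)).
apply/funext => i; have linT := fib_linT fib i.
case: (pselect (a i = unit0)) => [aiE|ne].
  rewrite value_empty// => -[t E]; have /asboolP := valP t.
  by rewrite E.
have Pi : P i by apply/asboolP.
have Ei : val (Sub i Pi : H) = i by rewrite SubK.
pose t : T i := exist _ (Sub i Pi : H) Ei.
rewrite (@value_single _ _ (aH \o iota i) t linT)//.
by move=> [t' E]; apply: eq_exist; apply: val_inj; rewrite E Ei.
Qed.

Lemma prod2_cancel : prod2 order_product (Some (0, 1)) (Some (1, 0)) = Some unit0.
Proof.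
congr Some; apply: valueE; first exact: linear_ole.
pose i0 : 'I_2 := ord0; pose i1 : 'I_2 := ord_max.
have I2 (i : 'I_2) : i = i0 \/ i = i1.
  by case: i => -[|[|]]// ?; [left|right]; exact: val_inj.
(* A limit cut would contain three distinct indices. *)
have nolim (le : 'I_2 -> 'I_2 -> Prop) A : linear_order le -> ~ limit_cut le A.
  move=> lin [_ [i Ai] nmax].
  have [j Aj nji] := nmax i Ai; have [k Ak nkj] := nmax j Aj.
  have ji : j <> i by move=> e; apply: nji; rewrite e; exact: (lin_refl lin).
  have kj : k <> j by move=> e; apply: nkj; rewrite e; exact: (lin_refl lin).
  have ki : k <> i by move=> e; apply: nkj; rewrite e; exact: (nle_le lin nji).
  by case: (I2 i) (I2 j) (I2 k) => ? [] ? [] ?; congruence.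
(* The walk has heights 0, 1, 0 at its three cuts. *)
pose h (A : set 'I_2) := if `[< A i0 /\ ~ A i1 >] then 1 else 0.
have h1 A : A i0 -> ~ A i1 -> h A = 1 by move=> A0 A1; rewrite /h asboolT.
have h0 A : ~ A i0 -> h A = 0 by move=> A0; rewrite /h asboolF => // -[].
have h0' A : A i1 -> h A = 0 by move=> A0; rewrite /h asboolF => // -[].
exists h, (fun=> 0), 0; split.
- split.
  + move=> i; have [->|->] := I2 i.
      rewrite h0; last by apply; exact: (lin_refl (linear_ole _)).
      by rewrite h1//; exact: (lin_refl (linear_ole _)).
    rewrite h1//; last by apply; exact: (lin_refl (linear_ole _)).
    by rewrite h0'//; exact: (lin_refl (linear_ole _)).
  + by move=> A /nolim-/(_ (linear_ole _)).
  + by move=> A /nolim-/(_ (linear_dual (linear_ole _))).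
- by split=> //; left; exists i0.
- by rewrite h0// h0'.
Qed.

Theorem theorem1p1 :
  exists (S : Type) (prod : partial_product S),
    complete_semigroup prod /\
    countable [set: S] /\
    exists a b e : S,
      a <> e /\ b <> e /\ prod2 prod a b = Some e /\
      complete_identity prod e.
Proof.
exists bicyclic0, order_product; split.
  by split; [exact: order_product_infsg|move=> d I a _; eexists].
split; first exact: countableP.
exists (Some (0, 1)), (Some (1, 0)), unit0; split=> //; split=> //.
by split; [exact: prod2_cancel|exact: order_product_identity].
Qed.
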